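(* Let $n\ge 1$ and $A\in\mathcal F_n$. Then $A$ is extendible if and only if there exists a choice $a_k\in\Omega_k^+(A)$ $(2\le k\le n)$ such that \[ \{2,\ldots,n+1\}\setminus A\subseteq\bigcup_{k=2}^{n}C_{k,a_k}(A). \]
   Context: For an integer $n\ge 1$ let $X_n=\{2,3,\ldots,n+1\}$. A truncated profile of length $n$ is a tuple $r=(r_2,\ldots,r_n)$ with $r_k\in\mathbb Z/k\mathbb Z$ for each $2\le k\le n$ (the empty tuple if $n=1$). Its survivor set is \[ S_n(r)=\{m\in X_n:\ m\not\equiv r_k\pmod k\text{ for every } 2\le k<m\}. \] Let $\mathcal F_n=\{S_n(r): r \text{ a truncated profile of length } n\}$. A set $A\in\mathcal F_n$ is called extendible if there exists a truncated profile $r=(r_2,\ldots,r_n)$ such that $S_n(r)=A$ and $r_k\not\equiv n+2\pmod k$ for every $2\le k\le n$. For $A\subseteq\{2,\ldots,n+1\}$ and $2\le k\le n$ define \[ \Omega_k^+(A)=(\mathbb Z/k\mathbb Z)\setminus\Bigl(\{m\bmod k:\ m\in A,\ m>k\}\cup\{(n+2)\bmod k\}\Bigr), \] and for $a\in\Omega_k^+(A)$ define \[ C_{k,a}(A)=\{m\in\{2,\ldots,n+1\}\setminus A:\ m>k,\ m\equiv a\pmod k\}. \] *)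

(* Defs.v *)
From mathcomp Require Import all_boot all_order all_algebra.

Set Implicit Arguments.
Unset Strict Implicit.
Unset Printing Implicit Defensive.

Import GRing.Theory.

Local Open Scope nat_scope.

(* Conventions.  The moduli 2, ..., n are indexed by k : 'I_n.-1, the index k
   standing for the modulus k.+2; there is none when n = 1.  Since k.+2 >= 2,
   the ring 'Z_(k.+2) really is Z/(k+2)Z, and m%:R is the residue of m.
   Subsets of {2, ..., n+1} are sets over 'I_n.+2 = {0, ..., n+1}. *)

Definition profile (n : nat) := {dffun forall k : 'I_n.-1, 'Z_(k.+2)}.

Definition X (n : nat) : {set 'I_n.+2} := [set m : 'I_n.+2 | 2 <= m].

Definition survivors (n : nat) (r : profile n) : {set 'I_n.+2} :=
  [set m in X n |
    [forall k : 'I_n.-1, (k.+2 < m) ==> ((m%:R)%R != r k)]].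

Definition survivor_sets (n : nat) : {set {set 'I_n.+2}} :=
  [set survivors r | r : profile n].

Definition extendible (n : nat) (A : {set 'I_n.+2}) : Prop :=
  exists r : profile n,
    survivors r = A /\ forall k : 'I_n.-1, r k != (n.+2%:R)%R.

Definition Omega_plus (n : nat) (A : {set 'I_n.+2}) (k : 'I_n.-1) :
    {set 'Z_(k.+2)} :=
  ~: ([set (m%:R)%R | m : 'I_n.+2 in A & k.+2 < m] :|: [set (n.+2%:R)%R]).

(* Only meaningful for a \in Omega_plus A k, but defined for every residue. *)
Definition C (n : nat) (A : {set 'I_n.+2}) (k : 'I_n.-1) (a : 'Z_(k.+2)) :
    {set 'I_n.+2} :=
  [set m in X n :\: A | (k.+2 < m) && ((m%:R)%R == a)].

(* Main.v *)
Require Import Defs.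
From mathcomp Require Import all_boot all_order all_algebra.

(** Say that r_k strikes m when k < m and m is congruent to r_k modulo k.  For a
    subset A of {2, ..., n+1}, a profile r has survivor set A exactly when no
    r_k strikes an element of A and every element of {2, ..., n+1} outside A is
    struck by some r_k.  The first condition, joined with the requirement that
    r_k differ from n+2 modulo k, says that each r_k lies in Omega_k^+(A); the
    second says that the sets C_{k, r_k}(A) cover the complement of A.  So the
    profiles witnessing extendibility are the very choices asked for
    ([survivors_avoidP]); that A is a survivor set serves only to place A
    inside {2, ..., n+1}. *)

Lemma survivorsP (n : nat) (r : profile n) (m : 'I_n.+2) :
  reflect (m \in X n /\ forall k : 'I_n.-1, k.+2 < m -> (m%:R)%R != r k)
          (m \in survivors r).
Proof.
rewrite [m \in survivors r]inE; apply: (iffP andP) => -[mX H]; split=> //.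
  by move=> k; move/forallP/(_ k)/implyP: H.
by apply/forallP => k; apply/implyP; apply: H.
Qed.

Lemma Omega_plusP (n : nat) (A : {set 'I_n.+2}) (k : 'I_n.-1) (a : 'Z_(k.+2)) :
  reflect ((forall m : 'I_n.+2, m \in A -> k.+2 < m -> (m%:R)%R != a) /\
           a != (n.+2%:R)%R)
          (a \in Omega_plus A k).
Proof.
rewrite !inE negb_or; apply: (iffP andP) => -[H an]; split=> //.
  move=> m mA km; apply: contra H => /eqP <-.
  by apply/imsetP; exists m; rewrite ?inE ?mA.
apply/imsetP => -[m]; rewrite inE => /andP[mA km] def_a.
by have := H m mA km; rewrite def_a eqxx.
Qed.

Lemma in_C (n : nat) (A : {set 'I_n.+2}) (k : 'I_n.-1) (a : 'Z_(k.+2))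
    (m : 'I_n.+2) :
  (m \in C A a) = [&& m \in X n :\: A, k.+2 < m & (m%:R)%R == a].
Proof. by rewrite inE. Qed.

(** The same profile serves on both sides, and A need not be known in advance
    to be a survivor set. *)
Lemma survivors_avoidP (n : nat) (A : {set 'I_n.+2}) (r : profile n) :
  A \subset X n ->
  (survivors r = A /\ forall k : 'I_n.-1, r k != (n.+2%:R)%R) <->
  (forall k : 'I_n.-1, r k \in Omega_plus A k) /\
    X n :\: A \subset \bigcup_(k : 'I_n.-1) C A (r k).
Proof.
move=> sAX; split=> [[defA avoid] | [rO cover]].
  split=> [k|].
    apply/Omega_plusP; split=> // m mA km.
    by move: mA; rewrite -defA => /survivorsP[_]; apply.
  apply/subsetP => m mXA; have /setDP[mX mNA] := mXA.
  have: m \notin survivors r by rewrite defA.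
  rewrite inE mX negb_and /= => /forallPn[k].
  rewrite negb_imply negbK => /andP[km rk].
  by apply/bigcupP; exists k; rewrite // in_C mXA km.
split=> [|k]; last by have /Omega_plusP[] := rO k.
apply/setP => m; apply/idP/idP => [/survivorsP[mX Hm] | mA].
  apply/negPn/negP => mNA.
  have mXA: m \in X n :\: A by apply/setDP.
  have /bigcupP[k _] := subsetP cover m mXA.
  by rewrite in_C => /and3P[_ /Hm/negP].
apply/survivorsP; split=> [|k km]; first exact: (subsetP sAX).
by have /Omega_plusP[H _] := rO k; apply: H.
Qed.

Theorem theorem26 (n : nat) (A : {set 'I_n.+2})
    (hn : 1 <= n) (hA : A \in survivor_sets n) :
  extendible A <->
  exists a : profile n,
    (forall k : 'I_n.-1, a k \in Omega_plus A k) /\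
    X n :\: A \subset \bigcup_(k : 'I_n.-1) C A (a k).
Proof.
have sAX : A \subset X n.
  by have /imsetP[r _ ->] := hA; apply/subsetP => m /survivorsP[].
by split=> -[r /(survivors_avoidP _ _ _ sAX) Hr]; exists r.
Qed.
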